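(* Let $$A(v,y,x)=\sum_{n\ge0}\sum_{\pi\in\mathfrak M_n}v^{\mathrm{lds}(\pi)}y^{\#\{\text{rises of }\pi\}}x^n.$$ Then $$A(v,y,x)=\frac{1-vx-\sqrt{1-2vx+(v^2-4vy)x^2}}{2vyx^2},$$ and moreover $$A(v,y,x)=\sum_{n\ge0}\sum_{m\ge0}\frac{1}{n+1}\binom{2n}{n}\binom{m+2n}{2n}x^{m+2n}v^{m+n}y^n.$$
   Context: A permutation $\pi=\pi_1\cdots\pi_n$ is a Motzkin permutation if it avoids the pattern $132$ (no $i<j<k$ with $\pi_i<\pi_k<\pi_j$) and there are no indices $a<b$ with $\pi_a<\pi_b<\pi_{b+1}$; $\mathfrak M_n$ denotes the set of Motzkin permutations of length $n$ ($\mathfrak M_0$ contains the empty permutation). $\mathrm{lds}(\pi)$ is the length of the longest decreasing subsequence of $\pi$, and a rise of $\pi$ is an index $i$ with $\pi_i<\pi_{i+1}$. *)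

(* Defs.v *)
From HB Require Import structures.
From mathcomp Require Import all_boot all_order all_fingroup all_algebra.
From mathcomp Require Import boolp.

Set Implicit Arguments.
Unset Strict Implicit.
Unset Printing Implicit Defensive.

Import Order.TTheory GRing.Theory Num.Theory.
Local Open Scope ring_scope.

(* Permutations of length n are elements of 'S_n, so positions and values are *)
(* numbered from 0 instead of 1.                                              *)
Section Permutations.
Variable n : nat.
Implicit Types pi : 'S_n.

Definition avoids132 pi : bool :=
  ~~ [exists i : 'I_n, exists j : 'I_n, exists k : 'I_n,
       [&& (i < j)%N, (j < k)%N, (pi i < pi k)%N & (pi k < pi j)%N]].

Definition motzkin pi : bool :=
  avoids132 pi &&
  ~~ [exists a : 'I_n, exists b : 'I_n, exists c : 'I_n,
       [&& (a < b)%N, c == b.+1 :> nat, (pi a < pi b)%N & (pi b < pi c)%N]].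

Definition decreasing_on pi (S : {set 'I_n}) : bool :=
  [forall i in S, forall j in S, (i < j)%N ==> (pi j < pi i)%N].

Definition lds pi : nat := (\max_(S : {set 'I_n} | decreasing_on pi S) #|S|)%N.

Definition rises pi : nat :=
  #|[set i : 'I_n | [exists j : 'I_n, (j == i.+1 :> nat) && (pi i < pi j)%N]]|.

End Permutations.

(* {fps R} is the ring R[[x]]; a record rather than an alias of nat -> R, so  *)
(* that no pointwise structure on functions can be inferred.                  *)
Record fps (R : Type) := Fps { fps_coef :> nat -> R }.
Notation "{ 'fps' R }" := (fps R) (at level 0, format "{ 'fps'  R }").

HB.instance Definition _ (R : Type) := gen_eqMixin {fps R}.
HB.instance Definition _ (R : Type) := gen_choiceMixin {fps R}.

Lemma fpsP (R : Type) (f g : {fps R}) : f =1 g <-> f = g.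
Proof.
split=> [|->//]; case: f g => [f] [g] /= fg.
by congr Fps; apply: funext.
Qed.

Section FpsZmodule.
Variable R : zmodType.
Implicit Types f g h : {fps R}.

Definition fps_zero : {fps R} := Fps (fun=> 0).
Definition fps_opp f : {fps R} := Fps (fun n => - f n).
Definition fps_add f g : {fps R} := Fps (fun n => f n + g n).

Fact fps_addA : associative fps_add.
Proof. by move=> f g h; apply/fpsP => n /=; rewrite addrA. Qed.
Fact fps_addC : commutative fps_add.
Proof. by move=> f g; apply/fpsP => n /=; rewrite addrC. Qed.
Fact fps_add0 : left_id fps_zero fps_add.
Proof. by move=> f; apply/fpsP => n /=; rewrite add0r. Qed.
Fact fps_addN : left_inverse fps_zero fps_opp fps_add.
Proof. by move=> f; apply/fpsP => n /=; rewrite addNr. Qed.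

HB.instance Definition _ :=
  GRing.isZmodule.Build {fps R} fps_addA fps_addC fps_add0 fps_addN.

Lemma coef0_fps n : (0 : {fps R}) n = 0. Proof. by []. Qed.
Lemma coefD_fps f g n : (f + g) n = f n + g n. Proof. by []. Qed.
Lemma coefN_fps f n : (- f) n = - f n. Proof. by []. Qed.

End FpsZmodule.

Section FpsRing.
Variable R : comNzRingType.
Implicit Types f g h : {fps R}.

Definition fpsC (c : R) : {fps R} := Fps (fun n => if n == 0%N then c else 0).
Definition fpsX : {fps R} := Fps (fun n => (n == 1%N)%:R).
Definition fps_mul f g : {fps R} :=
  Fps (fun n => \sum_(i < n.+1) f i * g (n - i)%N).

Let trunc (N : nat) f : {poly R} := \poly_(i < N.+1) f i.

Let truncE N f k : (k <= N)%N -> (trunc N f)`_k = f k.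
Proof. by move=> kN; rewrite coef_poly ltnS kN. Qed.

Let mul_trunc N f g k : (k <= N)%N ->
  fps_mul f g k = (trunc N f * trunc N g)`_k.
Proof.
move=> kN; rewrite coefM /=; apply: eq_bigr => i _.
have ik : (i <= k)%N by rewrite -ltnS.
by rewrite !truncE // ?(leq_trans ik) // (leq_trans (leq_subr _ _)).
Qed.

Fact fps_mulC : commutative fps_mul.
Proof.
by move=> f g; apply/fpsP => n; rewrite !(mul_trunc _ _ (leqnn n)) mulrC.
Qed.

Fact fps_mulA : associative fps_mul.
Proof.
move=> f g h; apply/fpsP => n.
have -> : fps_mul f (fps_mul g h) n = (trunc n f * (trunc n g * trunc n h))`_n.
  rewrite coefM; apply: eq_bigr => i _.
  by rewrite truncE -1?ltnS // (@mul_trunc n) ?leq_subr.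
rewrite mulrA coefM; apply: eq_bigr => i _.
by rewrite truncE ?leq_subr // (@mul_trunc n) // -ltnS.
Qed.

Fact fps_mul1 : left_id (fpsC 1) fps_mul.
Proof.
move=> f; apply/fpsP => n /=.
rewrite big_ord_recl /= subn0 mul1r big1 ?addr0 // => i _.
by rewrite mul0r.
Qed.

Fact fps_mulDl : left_distributive fps_mul +%R.
Proof.
move=> f g h; apply/fpsP => n; rewrite coefD_fps /= -big_split /=.
by apply: eq_bigr => i _; rewrite mulrDl.
Qed.

Fact fps_oner_neq0 : fpsC 1 != 0.
Proof.
apply/eqP => /(congr1 (fun f : {fps R} => f 0%N)) /= /eqP.
by rewrite oner_eq0.
Qed.

HB.instance Definition _ := GRing.Zmodule_isComNzRing.Build {fps R}
  fps_mulA fps_mulC fps_mul1 fps_mulDl fps_oner_neq0.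

Lemma coefM_fps f g n : (f * g) n = \sum_(i < n.+1) f i * g (n - i)%N.
Proof. by []. Qed.

Lemma coef1_fps n : (1 : {fps R}) n = if n == 0%N then 1 else 0.
Proof. by []. Qed.

Definition fps_unit : {pred {fps R}} := fun f => `[< exists g, g * f = 1 >].

Definition fps_inv f : {fps R} :=
  match pselect (exists g, g * f = 1) with
  | left inv_f => projT1 (cid inv_f)
  | right _ => f
  end.

Fact fps_mulVx : {in fps_unit, left_inverse 1 fps_inv *%R}.
Proof.
move=> f /asboolP uf; rewrite /fps_inv; case: pselect => // inv_f.
exact: (projT2 (cid inv_f)).
Qed.

Fact fps_unitPl f g : g * f = 1 -> fps_unit f.
Proof. by move=> gf; apply/asboolP; exists g. Qed.

Fact fps_inv_out : {in [predC fps_unit], fps_inv =1 id}.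
Proof.
move=> f; rewrite !inE => /asboolPn nuf.
by rewrite /fps_inv; case: pselect.
Qed.

HB.instance Definition _ := GRing.ComNzRing_hasMulInverse.Build {fps R}
  fps_mulVx fps_unitPl fps_inv_out.

End FpsRing.

Arguments fpsX {R}.

Section FpsIdomain.
Variable R : idomainType.
Implicit Types f g : {fps R}.

Let fps_order f : f != 0 ->
  exists2 m, f m != 0 & forall i, (i < m)%N -> f i = 0.
Proof.
move=> f0; have nz : exists n, f n != 0.
  apply: contrapT => nf; case/eqP: f0; apply/fpsP => n.
  by apply/eqP; apply: contrapT => /negP fn; apply: nf; exists n.
case: (ex_minnP nz) => m fm min_m; exists m => // i im.
by apply/eqP; apply: contraTT im => /min_m; rewrite -leqNgt.
Qed.

Fact fps_integral : GRing.integral_domain_axiom {fps R}.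
Proof.
move=> f g fg0; apply: contraT; rewrite negb_or => /andP[].
move=> /fps_order[m fm fm0] /fps_order[p gp gp0].
have /eqP : (f * g) (m + p)%N = 0 by rewrite fg0.
have mp : (m < (m + p).+1)%N by rewrite ltnS leq_addr.
rewrite coefM_fps (bigD1 (Ordinal mp)) //= addKn big1 ?addr0 => [|i im].
  by rewrite mulf_eq0 (negPf fm) (negPf gp).
case: (ltngtP i m) => [/fm0 -> | mi | im']; first by rewrite mul0r.
  by rewrite gp0 ?mulr0 // ltn_subLR ?ltn_add2r // -ltnS.
by case/eqP: im; apply: val_inj.
Qed.

HB.instance Definition _ :=
  GRing.ComUnitRing_isIntegral.Build {fps R} fps_integral.

End FpsIdomain.

(* The square root with constant coefficient 1 of a series with constant      *)
(* coefficient 1 (see fps_sqrtK and fps_sqrt_unique below).                   *)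
Section FpsSqrt.
Variable R : comUnitRingType.
Implicit Types D S : {fps R}.

Fixpoint sqrt_coefs D n : seq R :=
  if n is n'.+1 then
    let s := sqrt_coefs D n' in
    rcons s ((D n - \sum_(1 <= i < n) s`_i * s`_(n - i)) / 2)
  else [:: 1].

Definition fps_sqrt D : {fps R} := Fps (fun n => (sqrt_coefs D n)`_n).

Let size_sqrt D n : size (sqrt_coefs D n) = n.+1.
Proof. by elim: n => //= n IH; rewrite size_rcons IH. Qed.

Let nth_sqrt D n i : (i <= n)%N -> (sqrt_coefs D n)`_i = fps_sqrt D i.
Proof.
elim: n => [|n IH]; first by rewrite leqn0 => /eqP ->.
rewrite leq_eqVlt => /orP[/eqP -> // | lin].
by rewrite [sqrt_coefs D n.+1]/= nth_rcons size_sqrt lin IH.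
Qed.

Lemma fps_sqrt0 D : fps_sqrt D 0%N = 1. Proof. by []. Qed.

Lemma fps_sqrtS D n : fps_sqrt D n.+1 =
  (D n.+1 - \sum_(1 <= i < n.+1) fps_sqrt D i * fps_sqrt D (n.+1 - i)%N) / 2.
Proof.
rewrite {1}/fps_sqrt [LHS]/= nth_rcons size_sqrt ltnn eqxx.
congr ((_ - _) / _); apply: eq_big_nat => i /andP[i0 lin].
by rewrite !nth_sqrt // leq_subLR -addn1 addnC leq_add2r.
Qed.

Let coef_sqrS S n : S 0%N = 1 -> (S ^+ 2) n.+1 =
  S n.+1 * 2 + \sum_(1 <= i < n.+1) S i * S (n.+1 - i)%N.
Proof.
move=> S0; rewrite expr2 coefM_fps.
rewrite -(big_mkord xpredT (fun i => S i * S (n.+1 - i)%N)).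
rewrite big_nat_recl // subn0 S0 mul1r big_nat_recr //= subnn S0 mulr1.
by rewrite big_add1 /= mulr_natr mulr2n addrCA addrC.
Qed.

Lemma fps_sqrtK D :
  (2 : R) \is a GRing.unit -> D 0%N = 1 -> fps_sqrt D ^+ 2 = D.
Proof.
move=> u2 D0; apply/fpsP => -[|n].
  by rewrite expr2 coefM_fps big_ord1 !fps_sqrt0 mulr1 D0.
by rewrite coef_sqrS // fps_sqrtS mulrVK // subrK.
Qed.

Lemma fps_sqrt_unique S D :
  (2 : R) \is a GRing.unit -> S 0%N = 1 -> S ^+ 2 = D -> S = fps_sqrt D.
Proof.
move=> u2 S0 SD; apply/fpsP => n.
elim/ltn_ind: n => -[|n] IH; first by rewrite S0.
have E : \sum_(1 <= i < n.+1) S i * S (n.+1 - i)%N =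
    \sum_(1 <= i < n.+1) fps_sqrt D i * fps_sqrt D (n.+1 - i)%N.
  apply: eq_big_nat => i /andP[i0 lin].
  by rewrite !IH // ltn_subrL i0.
by rewrite fps_sqrtS -E -SD coef_sqrS // addrK mulrK.
Qed.

End FpsSqrt.

(* S is the sum of the family F of power series, over any (possibly infinite) *)
(* index type: each coefficient of the finite partial sums is eventually      *)
(* equal to that of S.                                                        *)
Definition fps_has_sum (R : comNzRingType) (I : eqType) (F : I -> {fps R})
    (S : {fps R}) : Prop :=
  forall k : nat, exists J0 : seq I, forall J : seq I,
    uniq J -> {subset J0 <= J} -> (\sum_(i <- J) F i) k = S k.

(* {poly {poly rat}} is Q[v][y].                                              *)
Definition var_v : {poly {poly rat}} := 'X%:P.
Definition var_y : {poly {poly rat}} := 'X.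

Definition motzkin_gf : {fps {poly {poly rat}}} :=
  Fps (fun n => \sum_(pi : 'S_n | motzkin pi) var_v ^+ lds pi * var_y ^+ rises pi).

(* Main.v *)
(* The maximal entry n of a Motzkin permutation is either its first entry or  *)
(* is preceded by an entry c: avoiding 132 puts every entry left of n above   *)
(* every entry right of n, and avoiding 1-23 makes c minimal among the        *)
(* entries left of n. So pi = n tau or pi = sigma c n tau with                *)
(* sigma > c > tau, where sigma and tau are arbitrary Motzkin words; lds and  *)
(* rises are additive up to the contribution of c n. This gives               *)
(*   A = 1 + v x A + v y x^2 A^2,                                             *)
(* whence 1 - v x - 2 v y x^2 A squares to the discriminant. The coefficients *)
(* C_n 'C(k, 2n) satisfy the same recurrence because of                       *)
(* \sum_i 'C(i, p) 'C(N - i, q) = 'C(N + 1, p + q + 1) and the convolution    *)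
(* formula for the Catalan numbers C_n.                                       *)

Require Import Defs.
From HB Require Import structures.
From mathcomp Require Import all_boot all_order all_fingroup all_algebra.
From mathcomp Require Import boolp.
From mathcomp Require Import ring zify.

Set Implicit Arguments.
Unset Strict Implicit.
Unset Printing Implicit Defensive.

Import Order.TTheory GRing.Theory Num.Theory.
Local Open Scope ring_scope.

(** * Words of natural numbers *)

(** Permutations are handled as words in one-line notation, because cutting a word at its maximum is
    list concatenation. [motz_words_perm] is the resulting decomposition of Motzkin words. The
    additivity of the statistics ([lds_cat], [rises_cat], [lds_valley], [rises_valley]) turns it
    into the recurrence [motzkin_gfS]. The explicit polynomials obey the same recurrence
    ([motzkin_polyS]), so [motzkin_gfE] identifies them with the coefficients of A. The double
    series follows, since only the finitely many pairs with m + 2n = k reach x^k. The closed form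
    comes from completing the square in [motzkin_gf_quadratic]: the root 1 - vx - 2vyx^2 A has
    constant coefficient 1, hence is the one singled out by [fps_sqrt_unique]. *)

Section Words.
Local Open Scope nat_scope.

Lemma sorted_cat_allrel (T : eqType) (r : rel T) (u w : seq T) :
  allrel r u w -> sorted r (u ++ w) = sorted r u && sorted r w.
Proof.
case: u => // a u /allrelP ruw; rewrite /= cat_path; congr (_ && _).
case: w ruw => //= b w ruw.
by rewrite ruw ?mem_last ?mem_head.
Qed.

(** In both relations the arguments come in order of position, and the names are in order of
    value. *)
Definition avoids132_from a : rel nat := fun c b => ~~ ((a < b) && (b < c)).
Definition avoids123_from a : rel nat := fun b c => ~~ ((a < b) && (b < c)).

(* The occurrences of 132 and 1-23 whose smallest entry is the head [a] are   *)
(* read off the tail: any two entries for 132, two adjacent ones for 1-23.    *)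
Fixpoint motzkin_seq (w : seq nat) : bool :=
  if w is a :: w' then
    [&& pairwise (avoids132_from a) w', sorted (avoids123_from a) w' & motzkin_seq w']
  else true.

Fixpoint rises_seq (w : seq nat) : nat :=
  if w is a :: w' then (if w' is b :: _ then a < b : nat else 0) + rises_seq w'
  else 0.

(** Subsequences are given by bit masks, so that the maximum ranges over a finite type. *)
Definition lds_seq (w : seq nat) : nat :=
  \max_(m : (size w).-tuple bool | sorted gtn (mask m w)) size (mask m w).

Lemma lds_seq_ub s w : subseq s w -> sorted gtn s -> size s <= lds_seq w.
Proof.
move=> /subseqP[m sm ->] ss; have /eqP sm' := sm.
exact: (@leq_bigmax_cond _ (fun m : (size w).-tuple bool => sorted gtn (mask m w))
  (fun m => size (mask m w)) (Tuple sm') ss).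
Qed.

Lemma lds_seq_ex w :
  exists s, [/\ subseq s w, sorted gtn s & size s = lds_seq w].
Proof.
have := @eq_bigmax_cond _
  (fun m : (size w).-tuple bool => sorted gtn (mask m w))
  (fun m => size (mask m w)).
case.
  apply/card_gt0P; exists [tuple of nseq (size w) false].
  by rewrite unfold_in /= mask_false.
move=> m ms eq_m; exists (mask m w); split=> //; exact: mask_subseq.

Qed.

Lemma lds_seq_le w k :
  (forall s, subseq s w -> sorted gtn s -> size s <= k) -> lds_seq w <= k.
Proof. by have [s [sw ss <-]] := lds_seq_ex w; apply. Qed.

(** * Patterns and statistics of joined words *)

(** Both patterns start with their smallest entry. If it lies in [u], the larger entries cannot lie
    in [w], so no occurrence straddles the two blocks. *)
Lemma motz_cat u w : allrel gtn u w -> motzkin_seq (u ++ w) = motzkin_seq u && motzkin_seq w.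
Proof.
elim: u => //= a u IH; rewrite allrel_consl => /andP[aw uw].
rewrite pairwise_cat IH //.
have dec_w : pairwise (avoids132_from a) w.
  apply/(pairwiseP 0) => i j _ jw _.
  by have := allP aw _ (mem_nth 0 jw); rewrite /avoids132_from /=; lia.
have inc_w : sorted (avoids123_from a) w.
  apply/(sortedP 0) => i iw.
  by have := allP aw _ (mem_nth 0 (ltnW iw)); rewrite /avoids123_from /=; lia.
have -> : allrel (avoids132_from a) u w.
  apply/allrelP => c b _ bw; have := allP aw _ bw.
  by rewrite /avoids132_from /=; lia.
rewrite sorted_cat_allrel ?dec_w ?inc_w ?andbT ?andbA //.
apply/allrelP => c b cu bw; have := allP aw _ bw.
have := allrelP uw _ _ cu bw.
by rewrite /avoids123_from /=; lia.
Qed.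

(** The maximum [n] in last position cannot end a 132. The entry [c] exceeds nothing before it, so
    it can only be the smallest entry of a pattern, and it has a single successor. *)
Lemma motz_valley u c n : all (gtn n) u -> all (ltn c) u -> c < n ->
  motzkin_seq (u ++ [:: c; n]) = motzkin_seq u.
Proof.
move=> + + cn; elim: u => [|a u IH] /=; first by [].
move=> /andP[an un] /andP[ca cu].
rewrite pairwise_cat IH //.
have -> : pairwise (avoids132_from a) [:: c; n] by rewrite /= /avoids132_from !andbT; lia.
have -> : allrel (avoids132_from a) u [:: c; n].
  apply/allrelP => d b du; rewrite !inE => /orP[] /eqP ->; rewrite /avoids132_from.
    by lia.
  by have := allP un _ du => /=; lia.
rewrite andbT; congr [&& _, _ & _]; case: u {IH} un cu => [|d u] un cu.
  by rewrite /= /avoids123_from andbT; lia.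
rewrite /= cat_path /= /avoids123_from.
have : last d u \in d :: u by exact: mem_last.
by move/(allP cu) => /=; move: (path _ _ _); lia.
Qed.

Lemma motz_map k w : motzkin_seq [seq k + i | i <- w] = motzkin_seq w.
Proof.
elim: w => //= a w ->; rewrite pairwise_map sorted_map.
congr [&& _, _ & _]; [apply: eq_pairwise | apply: eq_sorted];
  by move=> b c; rewrite /= /avoids132_from /avoids123_from !ltn_add2l.
Qed.

Lemma rises_cat u w : allrel gtn u w ->
  rises_seq (u ++ w) = rises_seq u + rises_seq w.
Proof.
elim: u => //= a u IH; rewrite allrel_consl => /andP[aw uw].
rewrite IH // addnA; congr (_ + _ + _).
case: u {IH uw} => //=; case: w aw => //= b w /andP[]; lia.
Qed.

Lemma rises_valley u c n : all (ltn c) u -> c < n ->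
  rises_seq (u ++ [:: c; n]) = (rises_seq u).+1.
Proof.
move=> cu cn; elim: u cu => [|a u IH] /=; first by rewrite cn.
move=> /andP[ca cu]; rewrite IH // addnS; congr ((_ + _).+1).
by case: u {IH cu} => //=; lia.
Qed.

Lemma rises_map k w : rises_seq [seq k + i | i <- w] = rises_seq w.
Proof. by elim: w => //= a [|b w] //= ->; rewrite ltn_add2l. Qed.

(** A decreasing subsequence restricts to each block, and decreasing subsequences of the two blocks
    concatenate. *)
Lemma lds_cat u w : allrel gtn u w ->
  lds_seq (u ++ w) = lds_seq u + lds_seq w.
Proof.
move=> /allrelP uw; apply/eqP; rewrite eqn_leq; apply/andP; split.
  apply: lds_seq_le => s /subseqP[m sm ->].
  move: sm; rewrite size_cat => sm.
  rewrite -(cat_take_drop (size u) m) mask_cat ?size_takel ?sm ?leq_addr //.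
  move=> /cat_sorted2[s1 s2]; rewrite size_cat.
  by rewrite leq_add // lds_seq_ub // mask_subseq.
have [s [su ss <-]] := lds_seq_ex u; have [t [tw st <-]] := lds_seq_ex w.
rewrite -size_cat; apply: lds_seq_ub; first exact: cat_subseq.
rewrite sorted_cat_allrel ?ss //; apply/allrelP => a b /(mem_subseq su) au.
by move=> /(mem_subseq tw); apply: uw.
Qed.

Lemma lds_seq1 a : lds_seq [:: a] = 1.
Proof.
apply/eqP; rewrite eqn_leq; apply/andP; split.
  by apply: lds_seq_le => s /size_subseq.
exact: (@lds_seq_ub [:: a]).
Qed.

(** A decreasing subsequence using the final maximum [n] is [n] alone; its length 1 is already
    attained in the nonempty [u]. *)
Lemma lds_rcons_max u n : all (gtn n) u -> u != [::] ->
  lds_seq (rcons u n) = lds_seq u.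
Proof.
move=> un u0; apply/eqP; rewrite eqn_leq; apply/andP; split; last first.
  have [s [su ss <-]] := lds_seq_ex u; apply: lds_seq_ub => //.
  exact: subseq_trans (subseq_rcons _ _).
apply: lds_seq_le => s; rewrite -cats1 => /subseqP[m sm ->].
move: sm; rewrite size_cat => sm.
rewrite -(cat_take_drop (size u) m) mask_cat ?size_takel ?sm ?leq_addr //.
have : subseq (mask (take (size u) m) u) u by exact: mask_subseq.
have : subseq (mask (drop (size u) m) [:: n]) [:: n] by exact: mask_subseq.
move: (mask _ u) (mask _ [:: n]) => s1 s2.
(* The bit [b] tells whether [n] is selected. *)
case/subseqP=> -[|b []] //= _ ->; case: b.
  case: s1 => [|a s1] /= su.
    move=> _; case: u u0 {un su sm} => // a u _.
    by apply: (@lds_seq_ub [:: a]) => //; rewrite sub1seq mem_head.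
  rewrite cat_path /= andbT => /andP[_].
  have : last a s1 \in u by apply: (mem_subseq su); exact: mem_last.
  by move=> /(allP un) /=; lia.
by rewrite cats0; apply: lds_seq_ub.
Qed.

(** The entry [c] prolongs every decreasing subsequence of [u]; the maximum [n] after it adds
    nothing. *)
Lemma lds_valley u c n : all (gtn n) u -> all (ltn c) u -> c < n ->
  lds_seq (u ++ [:: c; n]) = (lds_seq u).+1.
Proof.
move=> un cu cn.
rewrite -[_ ++ _]/(u ++ ([:: c] ++ [:: n])) catA cats1 lds_rcons_max.
- by rewrite lds_cat ?lds_seq1 ?addn1 // allrel1r.
- by rewrite all_cat un /= cn.
- by case: u {un cu}.
Qed.

Lemma lds_map k w : lds_seq [seq k + i | i <- w] = lds_seq w.
Proof.
have dmap s : sorted gtn [seq k + i | i <- s] = sorted gtn s.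
  by rewrite sorted_map; apply: eq_sorted => a b /=; rewrite ltn_add2l.
apply/eqP; rewrite eqn_leq; apply/andP; split.
  apply: lds_seq_le => s /subseqP[m _ ->]; rewrite -map_mask dmap size_map.
  by apply: lds_seq_ub; apply: mask_subseq.
have [s [sw ss <-]] := lds_seq_ex w; rewrite -(size_map (addn k)).
by apply: lds_seq_ub; rewrite ?dmap // map_subseq.
Qed.

(** * Splitting a word at its maximum *)

(** Sorting [w] and [u] separately and concatenating sorts the whole, so the result is the interval
    itself, cut at [size w]. *)
Lemma perm_cat_iota m k u w : perm_eq (u ++ w) (iota m k) -> allrel gtn u w ->
  perm_eq w (iota m (size w)) /\ perm_eq u (iota (m + size w) (size u)).
Proof.
move=> uwp uw.
have k_sz : k = size w + size u.
  by move/perm_size: (uwp); rewrite size_cat size_iota addnC.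
have wu_sorted : sorted leq (sort leq w ++ sort leq u).
  rewrite sorted_cat_allrel ?sort_sorted //; try exact: leq_total.
  apply/allrelP => b a; rewrite !mem_sort => bw au.
  exact: ltnW (allrelP uw _ _ au bw).
have : sort leq w ++ sort leq u = iota m (size w) ++ iota (m + size w) (size u).
  rewrite -iotaD -k_sz; apply: (sorted_eq leq_trans anti_leq) => //.
    exact: iota_sorted.
  apply: perm_trans uwp; rewrite perm_catC.
  by apply: perm_cat; rewrite perm_sort.
move/eqP; rewrite eqseq_cat ?size_sort ?size_iota // => /andP[/eqP <- /eqP <-].
by rewrite ![perm_eq _ (sort _ _)]perm_sym !perm_sort !perm_refl.
Qed.

Lemma motz_suffix u w : motzkin_seq (u ++ w) -> motzkin_seq w.
Proof. by elim: u => //= a u IH /and3P[_ _ /IH]. Qed.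

(** If a in [s] were below b in [t], then a, [n], b would form a 132. *)
Lemma motz_max_split s n t : uniq (s ++ n :: t) -> all (gtn n) (s ++ t) ->
  motzkin_seq (s ++ n :: t) -> allrel gtn s t.
Proof.
move=> w_uniq stn mw; apply/allrelP => a b as_ bt.
case/splitPr: as_ w_uniq stn mw => s1 s2 w_uniq stn mw.
have bn : b < n by apply: (allP stn); rewrite mem_cat bt orbT.
have ba : b != a.
  apply: contraTneq w_uniq => ba; rewrite -catA cat_uniq /= mem_cat inE -ba bt.
  by rewrite !orbT /= !andbF.
move: mw; rewrite -catA => /motz_suffix /= /and3P[+ _ _].
rewrite pairwise_cat /= => /and3P[_ _ /andP[/allP/(_ b bt)]].
by rewrite /avoids132_from /=; lia.
Qed.

(** Since [c] and [n] are adjacent, an entry of [s] below [c] would complete a 1-23. *)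
Lemma motz_valley_split s c n t : uniq (rcons s c ++ n :: t) ->
  all (gtn n) (rcons s c ++ t) -> motzkin_seq (rcons s c ++ n :: t) -> all (ltn c) s.
Proof.
move=> w_uniq stn mw; apply/allP => a as_.
case/splitPr: as_ w_uniq stn mw => s1 s2 w_uniq stn mw.
have cn : c < n by apply: (allP stn); rewrite mem_cat mem_rcons mem_head.
have ca : c != a.
  apply: contraTneq w_uniq => ca; rewrite cat_rcons -catA cat_uniq /= mem_cat inE ca.
  by rewrite eqxx orbT !andbF.
move: mw; rewrite cat_rcons -catA => /motz_suffix /= /and3P[_ + _].
case/cat_sorted2 => _ /= /andP[+ _].
by rewrite /avoids123_from /=; lia.
Qed.

Definition motz_words n : seq (seq nat) :=
  [seq w <- permutations (iota 0 n) | motzkin_seq w].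

Lemma mem_motz_words n w :
  (w \in motz_words n) = motzkin_seq w && perm_eq w (iota 0 n).
Proof. by rewrite mem_filter mem_permutations. Qed.

(** The valley entry is [j]: the second word takes the values below [j], and the first is shifted to
    those strictly between [j] and [n]. *)
Definition valley_join n j (p : seq nat * seq nat) :=
  ([seq j.+1 + i | i <- p.1] ++ [:: j; n]) ++ p.2.

Definition valley_words n : seq (seq nat) :=
  [seq valley_join n j p | j <- iota 0 n,
    p <- [seq (s, t) | s <- motz_words (n.-1 - j), t <- motz_words j]].

Lemma valley_bounds n j s t : j < n ->
    perm_eq s (iota 0 (n.-1 - j)) -> perm_eq t (iota 0 j) ->
  [/\ all (gtn n) [seq j.+1 + i | i <- s],
      all (ltn j) [seq j.+1 + i | i <- s] &
      allrel gtn ([seq j.+1 + i | i <- s] ++ [:: j; n]) t].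
Proof.
move=> jn sp tp.
have sb i : i \in s -> i < n.-1 - j.
  by rewrite (perm_mem sp) mem_iota.
have tb i : i \in t -> i < j by rewrite (perm_mem tp) mem_iota.
split.
- by apply/allP => _ /mapP[i /sb + ->] /=; lia.
- by apply/allP => _ /mapP[i /sb + ->] /=; lia.
- apply/allrelP => a b; rewrite mem_cat => + /tb bj.
  by case/orP => [/mapP[i _ ->]|]; rewrite /= ?inE; lia.
Qed.

Lemma motz_words_split n w :
  w \in motz_words n.+1 =
  ((w \in [seq n :: t | t <- motz_words n]) || (w \in valley_words n)).
Proof.
rewrite mem_motz_words.
have iotaS : perm_eq (iota 0 n.+1) (n :: iota 0 n).
  by rewrite -addn1 iotaD add0n perm_catC.
apply/idP/idP => [/andP[mw wp]|/orP[]]; last 2 first.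
- case/mapP => t; rewrite mem_motz_words => /andP[mt tp] ->.
  have nt : allrel gtn [:: n] t.
    rewrite allrel1l; apply/allP => i; rewrite (perm_mem tp) mem_iota /=; lia.
  rewrite -cat1s motz_cat // mt /= perm_sym (perm_trans iotaS) //.
  by rewrite perm_cons perm_sym.
- case/allpairsPdep => j [p [+ /allpairsP[[s t] /= [+ + ->]] ->]].
  rewrite mem_iota add0n !mem_motz_words => /andP[_ jn] /andP[ms sp] /andP[mt tp].
  have [sn js st] := valley_bounds jn sp tp.
  apply/andP; split; first by rewrite /valley_join motz_cat // motz_valley // motz_map ms.
  rewrite perm_sym; apply: (perm_trans iotaS).
  apply/seq.permP => P; rewrite /valley_join !count_cat /=.
  have -> : iota 0 n = iota 0 j ++ j :: iota j.+1 (n.-1 - j).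
    by rewrite -[_ :: _]/(iota j (n.-1 - j).+1) -iotaD; congr iota; lia.
  rewrite count_cat /= (seq.permP tp) (_ : iota j.+1 _ = [seq j.+1 + i | i <- iota 0 (n.-1 - j)]); last first.
    by rewrite -iotaDl addn0.
  rewrite !count_map (seq.permP sp) /=; lia.
have w_uniq : uniq w by rewrite (perm_uniq wp) iota_uniq.
have nw : n \in w by rewrite (perm_mem wp) mem_iota /=; lia.
case/splitPr: nw mw wp w_uniq => s t mw wp w_uniq.
have stp : perm_eq (s ++ t) (iota 0 n).
  by have := perm_trans wp iotaS; rewrite -cat1s perm_catCA perm_cons.
have stb : all (gtn n) (s ++ t).
  by apply/allP => i; rewrite (perm_mem stp) mem_iota.
have st := motz_max_split w_uniq stb mw.
have [tp sp] := perm_cat_iota stp st.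
rewrite add0n in sp.
(* Either [n] comes first, or some [c] immediately precedes it. *)
case/lastP: s => [|s c] in mw wp w_uniq stp stb st sp *.
  move: mw => /= /and3P[_ _ mt]; apply/orP; left.
  apply/mapP; exists t => //; rewrite mem_motz_words mt.
  by have := perm_size stp; rewrite size_iota => <-.
have cs := motz_valley_split w_uniq stb mw.
have sc : allrel gtn s [:: c] by rewrite allrel1r.
rewrite -cats1 in sp.
have wE : rcons s c ++ n :: t = (s ++ [:: c; n]) ++ t by rewrite cat_rcons -catA.
have /andP[ms mt] : motzkin_seq s && motzkin_seq t.
  move: mw stb st; rewrite wE all_cat all_rcons -cats1 allrel_catl.
  move=> + /andP[/andP[cn sn] tn] /andP[st ct].
  rewrite motz_cat ?motz_valley // allrel_catl st allrel_consl allrel_consl.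
  by rewrite -allrel1l ct tn.
have [/= cp sp'] := perm_cat_iota sp sc.
(* The entries of [t] are exactly the values below [c]. *)
have c_eq : c = size t by apply/eqP; have := perm_mem cp c; rewrite !inE eqxx.
have nE : n = (size s + size t).+1.
  by have := perm_size stp; rewrite size_cat size_rcons size_iota => <-.
(* The subtraction is exact, as every entry of [s] exceeds [c]. *)
pose s0 := [seq i - (size t).+1 | i <- s].
have s0K : [seq (size t).+1 + i | i <- s0] = s.
  rewrite -map_comp map_id_in // => i /(allP cs) /=; rewrite c_eq; exact: subnKC.
have s0p : perm_eq s0 (iota 0 (size s)).
  apply: (perm_map_inj (@addnI (size t).+1)); rewrite s0K -iotaDl.
  by rewrite addn0 -addn1.
apply/orP; right; apply/allpairsPdep; exists (size t), (s0, t); split.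
- by rewrite mem_iota add0n nE ltnS leq_addl.
- apply/allpairsP; exists (s0, t); split=> //=; rewrite mem_motz_words.
    by rewrite -(motz_map (size t).+1) s0K ms {1}nE /= addnK.
  by rewrite mt.
- by rewrite /valley_join /= s0K -c_eq wE.
Qed.

(** * Permutations and their words *)

Section PermWord.
Variable n : nat.
Implicit Types s : 'S_n.

Definition perm_word s : seq nat := [seq val (s i) | i <- enum 'I_n].

Lemma size_perm_word s : size (perm_word s) = n.
Proof. by rewrite size_map size_enum_ord. Qed.

Lemma nth_perm_word s (i : 'I_n) : nth 0 (perm_word s) i = s i.
Proof. by rewrite (nth_map i) ?size_enum_ord // nth_ord_enum. Qed.

Lemma perm_word_inj : injective perm_word.
Proof.
move=> s t st; apply/permP => i; apply: val_inj => /=.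
by rewrite -!nth_perm_word st.
Qed.

(** The words are distinct rearrangements of the interval, and there are n! on both sides. *)
Lemma perm_words_all :
  perm_eq [seq perm_word s | s <- enum 'S_n] (permutations (iota 0 n)).
Proof.
have words_uniq : uniq [seq perm_word s | s <- enum 'S_n].
  by rewrite map_inj_uniq ?enum_uniq //; apply: perm_word_inj.
have words_sub : {subset [seq perm_word s | s <- enum 'S_n]
    <= permutations (iota 0 n)}.
  move=> _ /mapP[s _ ->]; rewrite mem_permutations.
  rewrite -val_enum_ord /perm_word (map_comp val s).
  apply: perm_map; apply: uniq_perm; rewrite ?enum_uniq //.
    by rewrite map_inj_uniq ?enum_uniq //; apply: perm_inj.
  move=> i; rewrite mem_enum; apply/mapP; exists (s^-1%g i).
    by rewrite mem_enum.
  by rewrite permKV.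
apply: uniq_perm => //; first exact: permutations_uniq.
apply: (uniq_min_size words_uniq words_sub _).2.
rewrite size_permutations ?iota_uniq // size_iota size_map -cardE.
by rewrite card_Sn.
Qed.

Lemma motzP w : reflect
  ((forall i j k, i < j -> j < k -> k < size w ->
      ~~ ((nth 0 w i < nth 0 w k) && (nth 0 w k < nth 0 w j))) /\
   (forall a b, a < b -> b.+1 < size w ->
      ~~ ((nth 0 w a < nth 0 w b) && (nth 0 w b < nth 0 w b.+1))))
  (motzkin_seq w).
Proof.
elim: w => [|x w IH] /=; first by left; split.
apply: (iffP and3P) => [[/(pairwiseP 0) dw /(sortedP 0) iw /IH[mw1 mw2]]|].
  split=> [[|i] [|j] [|k] //|[|a] [|b] //].
  - by move=> _; rewrite !ltnS => jk kw; apply: dw; rewrite ?inE //; lia.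
  - by rewrite !ltnS; apply: mw1.
  - by rewrite !ltnS => _; apply: iw.
  - by rewrite !ltnS; apply: mw2.
move=> [m1 m2]; split.
- apply/(pairwiseP 0) => j k _ kw jk.
  by apply: (m1 0 j.+1 k.+1).
- by apply/(sortedP 0) => i iw; apply: (m2 0 i.+1).
- apply/IH; split=> [i j k ij jk kw|a b ab bw].
    exact: (m1 i.+1 j.+1 k.+1).
  exact: (m2 a.+1 b.+1).
Qed.

Lemma motz_perm_word s : motzkin_seq (perm_word s) = motzkin s.
Proof.
apply/motzP/andP; rewrite size_perm_word => -[m1 m2]; split.
- apply/existsP => -[i /existsP[j /existsP[k /and4P[ij jk]]]].
  rewrite -!nth_perm_word => ik kj.
  by have := m1 _ _ _ ij jk (ltn_ord k); rewrite ik kj.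
- apply/existsP => -[a /existsP[b /existsP[c /and4P[ab /eqP cb]]]].
  rewrite -!nth_perm_word cb => ab' bc; have := ltn_ord c; rewrite cb => bn.
  by have := m2 _ _ ab bn; rewrite ab' bc.
- move=> i j k ij jk kn; apply: contra m1 => /andP[ik kj].
  have jn := ltn_trans jk kn; have i_n := ltn_trans ij jn.
  apply/existsP; exists (Ordinal i_n); apply/existsP; exists (Ordinal jn).
  apply/existsP; exists (Ordinal kn).
  by rewrite -!nth_perm_word /= ij jk ik.
- move=> a b ab bn; apply: contra m2 => /andP[ab' bc].
  have bn' := ltnW bn; have an := ltn_trans ab bn'.
  apply/existsP; exists (Ordinal an); apply/existsP; exists (Ordinal bn').
  apply/existsP; exists (Ordinal bn).
  by rewrite -!nth_perm_word /= ab eqxx ab'.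
Qed.

Lemma rises_seq_sum w :
  rises_seq w = \sum_(0 <= i < size w) ((i.+1 < size w) && (nth 0 w i < nth 0 w i.+1)).
Proof.
elim: w => [|x w IH]; first by rewrite big_geq.
by rewrite big_nat_recl //= {}IH; case: w.
Qed.

Lemma rises_perm_word s : rises_seq (perm_word s) = rises s.
Proof.
rewrite rises_seq_sum size_perm_word big_mkord /rises -sum1_card [RHS]big_mkcond /=.
apply: eq_bigr => i _; rewrite inE; case: ifP => [/existsP[j /andP[/eqP ji]]|/existsP ri].
  by rewrite -!nth_perm_word ji => ->; rewrite -ji ltn_ord.
case: andP => // -[i1 ri']; case: ri; exists (Ordinal i1).
by rewrite eqxx -!nth_perm_word.
Qed.

(** A set of positions, listed increasingly, selects a subsequence, and conversely; decreasing sets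
    match decreasing subsequences. *)
Lemma lds_perm_word s : lds_seq (perm_word s) = lds s.
Proof.
have lt_tr : transitive (relpre (val : 'I_n -> nat) ltn).
  by move=> i j k /=; exact: ltn_trans.
have gt_tr : transitive (relpre (fun i => val (s i)) gtn).
  by move=> i j k /= ji ik; exact: ltn_trans ik ji.
have ord_lt : sorted (relpre val ltn) (enum 'I_n).
  by rewrite -sorted_map val_enum_ord iota_ltn_sorted.
apply/eqP; rewrite eqn_leq; apply/andP; split.
  apply: lds_seq_le => w /subseqP[m _ ->]; rewrite -map_mask size_map.
  have e_uniq : uniq (mask m (enum 'I_n)) by rewrite mask_uniq ?enum_uniq.
  have e_lt := subseq_sorted lt_tr (mask_subseq m _) ord_lt.
  rewrite sorted_map => e_gt.
  rewrite -(card_uniqP e_uniq) -cardsE.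
  apply: (@leq_bigmax_cond _ (decreasing_on s) (fun S : {set 'I_n} => #|S|)).
  apply/forall_inP => i; rewrite inE => ie; apply/forall_inP => j; rewrite inE => je.
  (* The selected positions are listed increasingly, so [i < j] forces the same order of their
     indices in the list. *)
  apply/implyP => ij; have := ltngtP (index i (mask m (enum 'I_n))) (index j (mask m (enum 'I_n))).
  case=> [lt|gt|/(congr1 (nth i (mask m (enum 'I_n))))]; last first.
  - by rewrite !nth_index // => eij; rewrite eij ltnn in ij.
  - have := sorted_ltn_index lt_tr e_lt _ _ je ie gt.
    by rewrite /= ltnNge ltnW.
  - exact: (sorted_ltn_index gt_tr e_gt _ _ ie je lt).
apply/bigmax_leqP => S /forall_inP dS.
have -> : #|S| = size [seq val (s i) | i <- enum S] by rewrite size_map cardE.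
have S_sub : subseq (enum S) (enum 'I_n).
  by rewrite enumT; exact: filter_subseq.
apply: lds_seq_ub; first exact: map_subseq.
have := subseq_sorted lt_tr S_sub ord_lt.
rewrite sorted_map; apply: (sub_in_sorted (P := mem S)) => [i j iS jS /= ij|].
  by have /forall_inP/(_ j jS) := dS i iS; rewrite ij.
by apply/allP => i; rewrite mem_enum.
Qed.

End PermWord.

End Words.

(** * Catalan numbers and the explicit coefficients *)

(** Choose p + q + 1 elements of {0,...,N} and classify by the (p+1)-st smallest, i. The proof is by
    induction with Pascal's rule. *)
Lemma sum_bin_conv N p q :
  (\sum_(i < N.+1) 'C(i, p) * 'C(N - i, q) = 'C(N.+1, p + q + 1))%N.
Proof.
elim: N p q => [|N IH] p q.
  by rewrite big_ord1 subnn addn1 binS !bin0n; case: p q => [|p] [|q].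
rewrite big_ord_recr /= subnn.
case: q => [|q].
  rewrite bin0 muln1 addn0 addn1 binS; have := IH p 0%N; rewrite addn0 addn1 => <-.
  by congr addn; apply: eq_bigr => i _; rewrite !bin0.
have -> : (p + q.+1 + 1 = (p + q + 1).+1)%N by lia.
rewrite bin0n muln0 addn0 binS -IH.
have -> : ((p + q + 1).+1 = p + q.+1 + 1)%N by lia.
rewrite -IH -big_split /=.
by apply: eq_bigr => i _; rewrite subSn -1?ltnS // binS mulnDr.
Qed.

Definition catalan n : rat := n.+1%:R^-1 * 'C(2 * n, n)%:R.

Lemma catalan0 : catalan 0 = 1.
Proof. by rewrite /catalan bin0 invr1 mulr1. Qed.

Lemma catalanS n : n.+2%:R * catalan n.+1 = (4 * n + 2)%:R * catalan n.
Proof.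
rewrite /catalan mulVKf ?pnatr_eq0 //.
(* Pass from ['C(2n+2, n+1)] to ['C(2n, n)] through ['C(2n+1, n)]. *)
have E : (n.+1 * 'C(2 * n.+1, n.+1) = (4 * n + 2) * 'C(2 * n, n))%N.
  have D1 := mul_bin_diag (2 * n.+1) n.
  have D2 := mul_bin_down (2 * n).+1 n.
  move: D1 D2; rewrite !mulnS /= (_ : (2 * n).+1 - n = n.+1)%N; last by lia.
  by rewrite add2n add1n /=; nia.
apply: (@mulfI _ n.+1%:R); first by rewrite pnatr_eq0.
by rewrite -natrM E natrM mulrCA mulVKf ?pnatr_eq0.
Qed.

(* Let S m be the convolution. By the symmetry i <-> m - i, the same sum       *)
(* weighted by i is m S(m) / 2; weighting S(m + 1) by i + 1 and using catalanS *)
(* then yields the recurrence of the Catalan numbers for S.                   *)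
Lemma catalan_conv n :
  \sum_(i < n.+1) catalan i * catalan (n - i) = catalan n.+1.
Proof.
pose S n := \sum_(i < n.+1) catalan i * catalan (n - i).
rewrite -/(S n).
have half m : \sum_(i < m.+1) (i%:R * 2) * (catalan i * catalan (m - i)) =
    m%:R * S m.
  pose F (i : 'I_m.+1) := catalan i * catalan (m - i).
  have E : \sum_(i < m.+1) i%:R * F i = \sum_(i < m.+1) (m - i)%:R * F i.
    rewrite (reindex_inj rev_ord_inj); apply: eq_bigr => i _ /=.
    by rewrite /F /= subSS subKn -1?ltnS // [catalan i * _]mulrC.
  transitivity (\sum_(i < m.+1) i%:R * F i + \sum_(i < m.+1) i%:R * F i).
    by rewrite -big_split; apply: eq_bigr => i _; rewrite /F /=; ring.
  rewrite {2}E -big_split /S mulr_sumr /=; apply: eq_bigr => i _.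
  by rewrite -mulrDl -natrD subnKC -1?ltnS.
have rec m : m.+3%:R * S m.+1 = 2 * (catalan m.+1 + m.+1%:R * 2 * S m).
  have -> : m.+3%:R * S m.+1 = m.+1%:R * S m.+1 + 2 * S m.+1.
    by rewrite -mulrDl -natrD addn2.
  rewrite -half {2}/S mulr_sumr -big_split /= big_ord_recl /= subn0 catalan0.
  (* The term i = 0 is split off; the factor is 2(4i + 2), produced by [catalanS] from the weight
     2(i + 2) of the shifted term. *)
  transitivity (2 * catalan m.+1 + \sum_(i < m.+1)
      (2 * 2 * (i%:R * 2) + 4) * (catalan i * catalan (m - i))).
    congr (_ + _); first by ring.
    apply: eq_bigr => i _; rewrite /bump add1n subSS.
    transitivity (2 * (i.+2%:R * catalan i.+1) * catalan (m - i)); first by ring.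
    by rewrite catalanS; ring.
  rewrite [RHS]mulrDr; congr (_ + _).
  transitivity (\sum_(i < m.+1) (4 * (i%:R * 2 * (catalan i * catalan (m - i)))
      + 4 * (catalan i * catalan (m - i)))).
    by apply: eq_bigr => i _; ring.
  by rewrite big_split /= -!mulr_sumr half -/(S m); ring.
elim: n => [|n IH].
  apply: (@mulfI _ 2); first by rewrite pnatr_eq0.
  by rewrite /S big_ord1 subn0 catalanS !catalan0; ring.
apply: (@mulfI _ n.+3%:R); first by rewrite pnatr_eq0.
by rewrite rec IH catalanS; ring.
Qed.

(** * The explicit polynomials *)

(** With k = m + 2n, this is the coefficient of x^k v^(k-n) y^n in the double series. *)
Definition motzkin_coef k n : rat := catalan n * 'C(k, 2 * n)%:R.

Lemma motzkin_coef_small k n : (k < 2 * n)%N -> motzkin_coef k n = 0.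
Proof. by move=> kn; rewrite /motzkin_coef bin_small ?mulr0. Qed.

Definition motzkin_poly k : {poly {poly rat}} :=
  \poly_(n < k.+1) ((motzkin_coef k n)%:P * 'X^(k - n)).

Lemma coef_motzkin_poly k n :
  (motzkin_poly k)`_n = (motzkin_coef k n)%:P * 'X^(k - n).
Proof.
rewrite coef_poly; case: ltnP => // kn.
by rewrite /motzkin_coef bin_small ?mulr0 ?mul0r //; lia.
Qed.

(** For fixed i, [sum_bin_conv] sums over j independently of i; [catalan_conv] then sums over i. *)
Lemma motzkin_coef_conv k n :
  \sum_(j < k.+1) \sum_(i < n.+1)
      motzkin_coef j i * motzkin_coef (k - j) (n - i) =
  catalan n.+1 * 'C(k.+1, 2 * n + 1)%:R.
Proof.
rewrite exchange_big /= -catalan_conv mulr_suml; apply: eq_bigr => i _.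
have -> : (2 * n + 1 = 2 * i + 2 * (n - i) + 1)%N by have := ltn_ord i; lia.
rewrite -sum_bin_conv natr_sum mulr_sumr; apply: eq_bigr => j _.
by rewrite /motzkin_coef natrM; ring.
Qed.

Lemma coefS_motzkin_coef k n :
  motzkin_coef k.+2 n.+1 =
  motzkin_coef k.+1 n.+1 + catalan n.+1 * 'C(k.+1, 2 * n + 1)%:R.
Proof.
by rewrite /motzkin_coef mulnS add2n binS natrD mulrDr addn1.
Qed.

(** The powers of v add up to i + j - n in every term whose two binomials are nonzero. *)
Lemma motzkin_poly_mul i j n :
  (motzkin_poly i * motzkin_poly j)`_n =
  (\sum_(l < n.+1) motzkin_coef i l * motzkin_coef j (n - l))%:P
    * 'X^(i + j - n).
Proof.
rewrite coefM rmorph_sum mulr_suml /=; apply: eq_bigr => l _.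
rewrite !coef_motzkin_poly mulrACA -polyCM -exprD.
case: (leqP (2 * l) i) => [li|li]; last first.
  by rewrite /motzkin_coef (bin_small li) mulr0 !mul0r.
case: (leqP (2 * (n - l)) j) => [lj|lj]; last first.
  by rewrite /motzkin_coef (bin_small lj) !mulr0 !mul0r.
by congr (_ * 'X^_); have := ltn_ord l; lia.
Qed.

(** Coefficientwise in y, this is Pascal's rule ([coefS_motzkin_coef]) combined with
    [motzkin_coef_conv]. *)
Lemma motzkin_polyS k :
  motzkin_poly k.+1 = var_v * motzkin_poly k +
    var_v * var_y * \sum_(j < k) motzkin_poly j * motzkin_poly (k.-1 - j).
Proof.
apply/polyP => n; rewrite coefD -mulrA !coefCM coefXM !coef_motzkin_poly.
case: n => [|n] /=.
  by rewrite mulr0 addr0 mulrCA -exprS !subn0 /motzkin_coef !bin0.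
case: k => [|k].
  by rewrite big_ord0 coef0 mulr0 addr0 !motzkin_coef_small ?polyC0 ?mul0r ?mulr0 //; lia.
rewrite coef_sum /=.
have -> : \sum_(j < k.+1) (motzkin_poly j * motzkin_poly (k - j))`_n =
    (catalan n.+1 * 'C(k.+1, 2 * n + 1)%:R)%:P * 'X^(k - n).
  rewrite -motzkin_coef_conv rmorph_sum mulr_suml /=; apply: eq_bigr => j _.
  by rewrite motzkin_poly_mul subnKC -1?ltnS.
rewrite coefS_motzkin_coef mulrCA -exprS [in X in _ = _ + X]mulrCA -exprS !subSS.
(* For n > k truncated subtraction makes the powers of v disagree, but all their coefficients
   vanish. *)
case: (leqP n k) => nk; last first.
  rewrite motzkin_coef_small; last by lia.
  by rewrite bin_small ?mulr0 ?addr0 ?polyC0 ?mul0r ?addr0 //; lia.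
rewrite subSn // polyCD mulrDl; congr (_ + _).
Qed.

Lemma motzkin_poly0 : motzkin_poly 0 = 1.
Proof.
apply/polyP => n; rewrite coef_motzkin_poly coef1 /motzkin_coef sub0n.
case: n => [|n]; first by rewrite catalan0 bin0 mulr1 mulr1.
by rewrite bin_small ?mulr0 ?mul0r.
Qed.

(** * The generating function *)

(** The position of [n] is recorded because it determines [j]; the entries [j], [n] add one to each
    statistic. *)
Lemma valley_stats n j s t : (j < n)%N ->
    perm_eq s (iota 0 (n.-1 - j)) -> perm_eq t (iota 0 j) ->
  [/\ index n (valley_join n j (s, t)) = (n.-1 - j).+1,
      lds_seq (valley_join n j (s, t)) = (lds_seq s + lds_seq t).+1 &
      rises_seq (valley_join n j (s, t)) = (rises_seq s + rises_seq t).+1].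
Proof.
move=> jn sp tp; have [sn js st] := valley_bounds jn sp tp.
rewrite /valley_join; split.
- have nS : n \notin [seq j.+1 + i | i <- s]%N.
    by apply/negP => /(allP sn) /=; rewrite ltnn.
  rewrite -catA /= index_cat (negPf nS) /= size_map (perm_size sp) size_iota.
  by rewrite eqxx (ltn_eqF jn) addn1.
- by rewrite lds_cat // lds_valley // lds_map.
- by rewrite rises_cat // rises_valley // rises_map.
Qed.

(** The position of [n] recovers [j]; the lengths are then known, so cutting recovers both words. *)
Lemma valley_words_uniq n : uniq (valley_words n).
Proof.
apply: allpairs_uniq_dep; first exact: iota_uniq.
  move=> j _; apply: allpairs_uniq; rewrite ?filter_uniq ?permutations_uniq //.
  by move=> [? ?] [? ?] _ _.
move=> _ _ /allpairsPdep[j [p [jn + ->]]] /allpairsPdep[j' [p' [jn' + ->]]].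
case/allpairsP=> -[s t] /= [+ + ->]; rewrite !mem_motz_words.
move=> /andP[_ sp] /andP[_ tp].
case/allpairsP=> -[s' t'] /= [+ + ->]; rewrite !mem_motz_words.
move=> /andP[_ sp'] /andP[_ tp'] eq_w.
rewrite mem_iota add0n /= in jn; rewrite mem_iota add0n /= in jn'.
have [index_w _ _] := valley_stats jn sp tp.
have [+ _ _] := valley_stats jn' sp' tp'.
rewrite -eq_w index_w => -[/eqP]; rewrite eqn_sub2lE; last 2 first.
- by rewrite -ltnS prednK // (leq_ltn_trans _ jn).
- by rewrite -ltnS prednK // (leq_ltn_trans _ jn).
move=> /eqP jj'; rewrite -{}jj' in sp' tp' eq_w *.
move/eqP: eq_w; rewrite /valley_join /= -!catA eqseq_cat; last first.
  by rewrite !size_map (perm_size sp) (perm_size sp').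
move=> /andP[/eqP/(inj_map (@addnI j.+1)) <-] /=.
by rewrite !eqseq_cons => /and3P[_ _ /eqP <-].
Qed.

(** The two families are disjoint: [n] is at index 0 in the first and at a positive index in the
    second. *)
Lemma motz_words_perm n : perm_eq (motz_words n.+1)
  ([seq n :: t | t <- motz_words n] ++ valley_words n).
Proof.
apply: uniq_perm; first by rewrite filter_uniq ?permutations_uniq.
  rewrite cat_uniq valley_words_uniq map_inj_uniq ?andbT; last by move=> ? ? [].
  rewrite filter_uniq ?permutations_uniq //=.
  apply/hasPn => w /allpairsPdep[j [p [+ /allpairsP[[s t] /= [+ + ->]] ->]]].
  rewrite mem_iota add0n !mem_motz_words => /= jn /andP[_ sp] /andP[_ tp].
  have [index_w _ _] := valley_stats jn sp tp.
  apply/negP => /mapP[t' _ eq_w].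
  by move: index_w; rewrite eq_w /= eqxx.
by move=> w; rewrite mem_cat motz_words_split.
Qed.

Definition word_weight (w : seq nat) : {poly {poly rat}} :=
  var_v ^+ lds_seq w * var_y ^+ rises_seq w.

Lemma motzkin_gf_words n : motzkin_gf n = \sum_(w <- motz_words n) word_weight w.
Proof.
rewrite big_filter -(perm_big _ (perm_words_all n)) big_map big_enum_cond /=.
apply: eq_big => s; first by rewrite motz_perm_word.
by rewrite /word_weight lds_perm_word rises_perm_word.
Qed.

Lemma motzkin_gf0 : motzkin_gf 0 = 1.
Proof.
rewrite motzkin_gf_words (_ : motz_words 0 = [:: [::]]) // big_seq1.
rewrite /word_weight (_ : lds_seq [::] = 0%N) ?mulr1 //.
by apply/eqP; rewrite -leqn0; apply: lds_seq_le => s /size_subseq.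
Qed.

(** Coefficient form of A = 1 + vxA + vyx^2 A^2; here j is the length of the part after the
    maximum. *)
Lemma motzkin_gfS n : motzkin_gf n.+1 = var_v * motzkin_gf n +
  var_v * var_y * \sum_(j < n) motzkin_gf j * motzkin_gf (n.-1 - j)%N.
Proof.
rewrite !motzkin_gf_words (perm_big _ (motz_words_perm n)) big_cat big_map.
congr (_ + _).
  rewrite mulr_sumr; apply: eq_big_seq => t; rewrite mem_motz_words => /andP[_ tp].
  have nt : allrel gtn [:: n] t.
    by rewrite allrel1l; apply/allP => i; rewrite (perm_mem tp) mem_iota.
  by rewrite -cat1s /word_weight lds_cat // rises_cat // lds_seq1 exprS mulrA.
rewrite big_allpairs_dep mulr_sumr -(big_mkord xpredT (fun j =>
  var_v * var_y * (motzkin_gf j * motzkin_gf (n.-1 - j)%N))).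
rewrite /index_iota subn0; apply: eq_big_seq => j; rewrite mem_iota add0n => jn.
rewrite big_allpairs.
transitivity (\sum_(s <- motz_words (n.-1 - j)) \sum_(t <- motz_words j)
    var_v * var_y * (word_weight t * word_weight s)).
  apply: eq_big_seq => s; rewrite mem_motz_words => /andP[_ sp].
  apply: eq_big_seq => t; rewrite mem_motz_words => /andP[_ tp].
  have [_ lds_w rises_w] := valley_stats jn sp tp.
  by rewrite /word_weight lds_w rises_w !exprS !exprD; ring.
rewrite exchange_big !motzkin_gf_words mulr_suml mulr_sumr /=.
by apply: eq_bigr => t _; rewrite !mulr_sumr.
Qed.

Lemma motzkin_gfE n : motzkin_gf n = motzkin_poly n.
Proof.
elim/ltn_ind: n => -[|n] IH; first by rewrite motzkin_gf0 motzkin_poly0.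
rewrite motzkin_gfS motzkin_polyS IH //; congr (_ + _ * _).
by apply: eq_bigr => j _; rewrite !IH //; have := ltn_ord j; lia.
Qed.

(** * Power series identities *)

Lemma coef_fpsCM (R : comNzRingType) (c : R) (f : {fps R}) n :
  (fpsC c * f) n = c * f n.
Proof.
rewrite coefM_fps big_ord_recl /= subn0 big1 ?addr0 // => i _.
by rewrite mul0r.
Qed.

Lemma coef_fpsXnM (R : comNzRingType) k (f : {fps R}) n :
  (fpsX ^+ k * f) n = if (n < k)%N then 0 else f (n - k)%N.
Proof.
have coefXM (g : {fps R}) m : (fpsX * g) m = if m is m'.+1 then g m' else 0.
  rewrite coefM_fps big_ord_recl /= mul0r add0r; case: m => [|m].
    by rewrite big_ord0.
  rewrite big_ord_recl /= mul1r subn1 big1 ?addr0 // => i _.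
  by rewrite mul0r.
elim: k n => [|k IH] n; first by rewrite expr0 mul1r subn0.
by rewrite exprS -mulrA coefXM; case: n => [|n] //; rewrite IH subSS.
Qed.

Lemma fpsC_is_nmod_morphism (R : comNzRingType) : nmod_morphism (@fpsC R).
Proof.
by split=> [|a b]; apply/fpsP => -[|n] //=; rewrite addr0.
Qed.

Lemma fpsC_is_monoid_morphism (R : comNzRingType) : monoid_morphism (@fpsC R).
Proof.
split=> // a b; apply/fpsP => -[|n]; rewrite coef_fpsCM //=.
by rewrite mulr0.
Qed.

HB.instance Definition _ (R : comNzRingType) :=
  GRing.isNmodMorphism.Build R {fps R} (@fpsC R) (@fpsC_is_nmod_morphism R).
HB.instance Definition _ (R : comNzRingType) :=
  GRing.isMonoidMorphism.Build R {fps R} (@fpsC R) (@fpsC_is_monoid_morphism R).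

Lemma motzkin_gf_quadratic :
  let v : {fps {poly {poly rat}}} := fpsC var_v in
  let y : {fps {poly {poly rat}}} := fpsC var_y in
  motzkin_gf = 1 + fpsX * (v * motzkin_gf)
    + fpsX ^+ 2 * (v * y * motzkin_gf ^+ 2).
Proof.
move=> v y; apply/fpsP => n; rewrite !coefD_fps -[fpsX in fpsX * _]expr1 !coef_fpsXnM.
rewrite -rmorphM !coef_fpsCM coef1_fps.
case: n => [|[|n]].
- by rewrite motzkin_gf0 !addr0.
- by rewrite motzkin_gfS big_ord0 mulr0 add0r.
- by rewrite motzkin_gfS add0r !subSS !subn0 expr2 coefM_fps.
Qed.

Lemma fpsC_eq0 (R : comNzRingType) (c : R) : (fpsC c == 0) = (c == 0).
Proof.
apply/eqP/eqP => [/(congr1 (fun f : {fps R} => f 0%N)) //|->]; exact: rmorph0.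
Qed.

Lemma fpsX_neq0 (R : comNzRingType) : (fpsX : {fps R}) != 0.
Proof.
apply/eqP => /(congr1 (fun f : {fps R} => f 1%N)) /= /eqP.
by rewrite oner_eq0.
Qed.

Lemma coef_fps_sum (R : comNzRingType) I (J : seq I) (F : I -> {fps R}) k :
  (\sum_(i <- J) F i) k = \sum_(i <- J) F i k.
Proof. exact: (big_morph (fun f : {fps R} => f k)). Qed.

Lemma motzkin_poly_sum k : motzkin_poly k =
  \sum_(n <- iota 0 k.+1 | (2 * n <= k)%N)
    (motzkin_coef k n)%:P%:P * var_v ^+ (k - n) * var_y ^+ n.
Proof.
rewrite [LHS]poly_def -(big_mkord xpredT
  (fun n => ((motzkin_coef k n)%:P * 'X^(k - n)) *: 'X^n)).
rewrite /index_iota subn0 [RHS]big_mkcond; apply: eq_bigr => n _.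
rewrite -mul_polyC polyCM rmorphXn; case: leqP => // kn.
by rewrite motzkin_coef_small // !polyC0 !mul0r.
Qed.

Lemma unit2_poly_poly_rat : (2 : {poly {poly rat}}) \is a GRing.unit.
Proof.
apply/unitrPr; exists (2^-1)%:P%:P.
by rewrite -2!(rmorph_nat polyC) -!polyCM mulfV.
Qed.

Theorem theorem2p2 :
  let v : {fps {poly {poly rat}}} := fpsC var_v in
  let y : {fps {poly {poly rat}}} := fpsC var_y in
  let x : {fps {poly {poly rat}}} := fpsX in
  FracField.tofrac motzkin_gf =
    FracField.tofrac
      (1 - v * x - fps_sqrt (1 - 2 * v * x + (v ^+ 2 - 4 * v * y) * x ^+ 2))
    / FracField.tofrac (2 * v * y * x ^+ 2)
  /\
  fps_has_sum
    (fun nm : nat * nat =>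
       let n := nm.1 in
       let m := nm.2 in
       let c : rat :=
         n.+1%:R^-1 * 'C(2 * n, n)%:R * 'C(m + 2 * n, 2 * n)%:R in
       fpsC c%:P%:P * x ^+ (m + 2 * n) * v ^+ (m + n) * y ^+ n)
    motzkin_gf.
Proof.
move=> v y x; split.
  have quad : motzkin_gf = 1 + x * (v * motzkin_gf) +
      x ^+ 2 * (v * y * motzkin_gf ^+ 2) := motzkin_gf_quadratic.
  (* The candidate root; powers of x stand in front, as [x ^+ 1] and [x ^+ 2], to fit
     [coef_fpsXnM]. *)
  pose S := 1 - x ^+ 1 * v - x ^+ 2 * (2 * v * y * motzkin_gf).
  have <- : S = fps_sqrt (1 - 2 * v * x + (v ^+ 2 - 4 * v * y) * x ^+ 2).
    apply: fps_sqrt_unique; first exact: unit2_poly_poly_rat.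
      by rewrite !coefD_fps !coefN_fps !coef_fpsXnM !subr0.
    (* The parenthesized factor equals 1 by [quad]. *)
    transitivity (1 - 2 * v * x + v ^+ 2 * x ^+ 2 - 4 * v * y * x ^+ 2 *
      (motzkin_gf - x * (v * motzkin_gf) - x ^+ 2 * (v * y * motzkin_gf ^+ 2))).
      by rewrite /S; ring.
    rewrite {1}quad; ring.
  have -> : 1 - v * x - S = motzkin_gf * (2 * v * y * x ^+ 2).
    by rewrite /S; ring.
  (* Cancellation in the fraction field needs only that 2, v, y and x are nonzero. *)
  rewrite rmorphM mulfK // tofrac_eq0 !mulf_neq0 ?expf_neq0 ?fpsX_neq0 //.
  - rewrite -(rmorph_nat (@fpsC _)) fpsC_eq0.
    by apply: contraTneq unit2_poly_poly_rat => ->; rewrite unitr0.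
  - by rewrite fpsC_eq0 polyC_eq0 polyX_eq0.
  - by rewrite fpsC_eq0 polyX_eq0.
move=> k.
(* These are the pairs with m + 2n = k, the only ones contributing to x^k. *)
pose J0 := [seq (n, (k - 2 * n)%N) | n <- iota 0 k.+1 & (2 * n <= k)%N].
exists J0 => J J_uniq J0_J.
pose F (nm : nat * nat) : {poly {poly rat}} :=
  (motzkin_coef (nm.2 + 2 * nm.1) nm.1)%:P%:P
    * var_v ^+ (nm.2 + nm.1) * var_y ^+ nm.1.
rewrite coef_fps_sum motzkin_gfE motzkin_poly_sum.
have coef_term n m c : (fpsC c%:P%:P * x ^+ (m + 2 * n) * v ^+ (m + n) * y ^+ n) k =
    if (m + 2 * n == k)%N then c%:P%:P * var_v ^+ (m + n) * var_y ^+ n else 0.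
  rewrite -!mulrA mulrCA coef_fpsXnM -!rmorphXn -!rmorphM /= subn_eq0.
  by case: ltngtP.
transitivity (\sum_(nm <- J | (nm.2 + 2 * nm.1 == k)%N) F nm).
  by rewrite [RHS]big_mkcond; apply: eq_bigr => nm _; rewrite coef_term.
have J0P : perm_eq [seq nm <- J | (nm.2 + 2 * nm.1 == k)%N] J0.
  apply: uniq_perm; first exact: filter_uniq.
    by rewrite map_inj_uniq ?filter_uniq ?iota_uniq // => n n' [].
  move=> [n m]; rewrite mem_filter /=; apply/andP/idP => [[/eqP kE _]|nm].
    apply/mapP; exists n; last by rewrite -kE addnK.
    by rewrite mem_filter mem_iota; lia.
  split; last exact: J0_J.
  case/mapP: nm => i; rewrite mem_filter => /andP[ik _] [-> ->].
  by rewrite subnK.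
rewrite -big_filter (perm_big _ J0P) big_map big_filter.
apply: eq_bigr => n nk; rewrite /F /= subnK //.
by rewrite (_ : (k - 2 * n + n = k - n)%N) //; lia.
Qed.
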